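(* Assume: (a) $G_C=G$ does not depend on $C\in\Theta^2$; (b) $\mathbf X$ is finite and $\mathsf P_G(X_t=x)>0$ for all $x\in\mathbf X$; (c) $0<I(\theta,\vartheta\mid x)<\infty$ for all $\theta\neq\vartheta$ in $\Theta$ and all $x$; (d) for every $x\in\mathbf X$, $\theta\mapsto\mu_\theta(x)$ is strictly increasing on $\Theta$ (so for every $C$ the preferred arm $M_C(x)$ does not depend on $x$). Let $\{\phi_\tau\}$ be any uniformly good rule and let $C_0=(\theta_1,\theta_2)$ with $\theta_1<\theta_2$ (so arm 2 is preferred for all $x$ and $T_{inf}(t)=T_1(t)$). Define $$K_{C_0}=\inf_{\theta\in\Theta:\ \theta>\theta_2}\ \sup_{x\in\mathbf X} I(\theta_1,\theta\mid x).$$ Then for every $\epsilon>0$, $$\lim_{t\to\infty}\mathsf P_{C_0}\Big(T_{inf}(t)\ge\frac{(1-\epsilon)\log t}{K_{C_0}}\Big)=1,\qquad \liminf_{t\to\infty}\frac{\mathsf E_{C_0}\{T_{inf}(t)\}}{\log t}\ge\frac1{K_{C_0}}.$$ The symmetric statement (with the roles of the arms exchanged, $K_{C_0}=\inf_{\theta>\theta_1}\sup_x I(\theta_2,\theta\mid x)$ and $T_{inf}=T_2$) holds when $\theta_1>\theta_2$.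
   Context: Two-armed bandit with side observations. $\Theta\subset\mathbb R$ is a parameter set and $\mathbf X\subset\mathbb R$. Known conditional distributions $\{F_\theta(dy\mid x)\}_{\theta\in\Theta}$ on $\mathbb R$ and a known law $G$ on $\mathbf X$. Under the (unknown) configuration $C_0=(\theta_1,\theta_2)\in\Theta^2$, the side observations $X_1,X_2,\dots$ are i.i.d. with law $G$, and for each arm $i\in\{1,2\}$ the pairs $(X_t,Y^i_t)$ are i.i.d. in $t$ with joint law $G(dx)F_{\theta_i}(dy\mid x)$. An allocation rule is a sequence $\phi_t\in\{1,2\}$ where $\phi_t$ depends only on $X_1,\dots,X_t$ and the previously observed rewards $Y^{\phi_\tau}_\tau$, $\tau<t$. $\mathsf P_C,\mathsf E_C$ denote probability/expectation under configuration $C$. $\mu_\theta(x)=\int y\,F_\theta(dy\mid x)$ (assumed finite); $M_C(x)=\arg\max_{i}\mu_{i(C)}(x)$ where $1(C)=\theta_1,2(C)=\theta_2$. $T_i(t)=\sum_{\tau=1}^t1\{\phi_\tau=i\}$; $T_{inf}(t)=\sum_{\tau=1}^t 1\{\phi_\tau\neq M_{C_0}(X_\tau)\}$. $I(\theta,\vartheta\mid x)$ is the Kullback–Leibler number between $F_\theta(\cdot\mid x)$ and $F_\vartheta(\cdot\mid x)$. A rule is uniformly good if for all $C\in\Theta^2$ and all $\alpha>0$, $\mathsf E_C\{T_{inf}(t)\}=o(t^\alpha)$. Conventions: $\inf\emptyset=\infty$, $1/\infty=0$.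
   Formalization: The probability limit is stated only when K_{C_0} > 0, since for K_{C_0} = 0 (possible under (a)–(d)) the threshold (1−ε) log t / K_{C_0} is undefined or infinite and the claim fails; the liminf bound is stated for every K_{C_0}, with 1/0 = ∞. *)

(* Defs.v *)
From HB Require Import structures.
From mathcomp Require Import all_boot all_order all_algebra.
From mathcomp Require Import all_classical all_reals all_analysis.
Set Implicit Arguments. Unset Strict Implicit. Unset Printing Implicit Defensive.
Import Order.TTheory GRing.Theory Num.Theory.
Import numFieldNormedType.Exports.
Local Open Scope classical_set_scope.
Local Open Scope ring_scope.

Definition KL (R : realType) (P Q : probability R R) : \bar R :=
  if pselect (P `<< Q) is left _ then
    (\int[P]_y (ln (fine (charge.Radon_Nikodym (charge_of_finite_measure P) Q y)))%:E)%E
  else +oo%E.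

Definition rule (X : finType) (R : realType) :=
  forall n : nat, n.-tuple X -> X -> n.-tuple R -> bool.

Definition measurable_rule (X : finType) (R : realType) (phi : rule X R) :=
  forall n (xs : n.-tuple X) (x : X), measurable_fun setT (phi n xs x).

Definition arm_param (R : realType) (C : R * R) (a : bool) : R :=
  if a then C.2 else C.1.

Definition mean (X : finType) (R : realType) (F : R -> X -> probability R R)
  (th : R) (x : X) : R := fine (\int[F th x]_y (y%:E))%E.

Definition inferior (X : finType) (R : realType) (F : R -> X -> probability R R)
  (C : R * R) (x : X) (a : bool) : bool :=
  mean F (arm_param C a) x < mean F (arm_param C (~~ a)) x.

Fixpoint evalW (X : finType) (R : realType) (g : X -> R)
  (F : R -> X -> probability R R) (phi : rule X R) (C : R * R)
  (h : nat -> \bar R) (m : nat) {struct m} :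
  forall k, k.-tuple X -> k.-tuple R -> nat -> \bar R :=
  match m with
  | 0 => fun k xs ys c => h c
  | m'.+1 => fun k xs ys c =>
      (\sum_(x : X) (g x)%:E *
         \int[F (arm_param C (phi k xs x ys)) x]_y
            evalW g F phi C h m' [tuple of rcons xs x] [tuple of rcons ys y]
              (c + inferior F C x (phi k xs x ys)))%E
  end.

Definition E_Tinf (X : finType) (R : realType) (g : X -> R)
  (F : R -> X -> probability R R) (phi : rule X R) (C : R * R)
  (h : nat -> \bar R) (t : nat) : \bar R :=
  evalW g F phi C h t [tuple] [tuple] 0%N.

Definition P_Tinf_ge (X : finType) (R : realType) (g : X -> R)
  (F : R -> X -> probability R R) (phi : rule X R) (C : R * R)
  (a : \bar R) (t : nat) : \bar R :=
  E_Tinf g F phi C (fun c => if (a <= (c%:R)%:E)%E then 1%E else 0%E) t.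

Definition mean_Tinf (X : finType) (R : realType) (g : X -> R)
  (F : R -> X -> probability R R) (phi : rule X R) (C : R * R)
  (t : nat) : \bar R :=
  E_Tinf g F phi C (fun c => (c%:R)%:E) t.

Definition uniformly_good (X : finType) (R : realType) (Theta : set R)
  (g : X -> R) (F : R -> X -> probability R R) (phi : rule X R) :=
  forall C : R * R, Theta C.1 -> Theta C.2 ->
  forall alpha : R, 0 < alpha ->
  (fun t : nat => (mean_Tinf g F phi C t / ((t%:R) `^ alpha)%:E)%E) @ \oo
    --> 0%E.

Definition KLx (X : finType) (R : realType) (F : R -> X -> probability R R)
  (th vth : R) (x : X) : \bar R := KL (F th x) (F vth x).

Definition K_const (X : finType) (R : realType) (Theta : set R)
  (F : R -> X -> probability R R) (lo hi : R) : \bar R :=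
  ereal_inf [set ereal_sup [set KLx F lo th x | x in [set: X]]
            | th in [set th | Theta th /\ hi < th]].

(* Main.v *)
Require Import Defs.
From HB Require Import structures.
From mathcomp Require Import all_boot all_order all_algebra.
From mathcomp Require Import all_classical all_reals all_analysis.
From mathcomp Require Import measurable_realfun ring lra zify.
Set Implicit Arguments. Unset Strict Implicit. Unset Printing Implicit Defensive.
Import Order.TTheory GRing.Theory Num.Theory.
Import numFieldNormedType.Exports.
Local Open Scope classical_set_scope.
Local Open Scope ring_scope.

(** Let [a] be the inferior arm under [C], and let [C'] replace its parameter by
    some [th] in [Theta] above both parameters, so that [a] becomes the better
    arm.  Under [C'] a uniformly good rule plays [a] fewer than
    [N ~ (1 - eps) log t / k] times with probability [o(t^(alpha - 1))], where
    [k] bounds the Kullback-Leibler numbers.  Changing measure back to [C] costs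
    a factor [exp L] with [L] the log-likelihood ratio, a sum of fewer than [N]
    increments of conditional mean at most [k]; so [L <= (1 - eps / 4) log t]
    with high probability and the event is also negligible under [C].

    The increments are only integrable, hence each is split into a clamped
    part, controlled by an exponential supermartingale, and an excess of small
    mean, controlled by Markov's inequality.  Both supermartingales and the
    change of measure are carried through a single induction on the remaining
    horizon in [evalW_change_of_configuration]. *)

(** * Measurability, monotonicity and linearity of the expectation recursion *)

Lemma measurable_rcons (R : realType) (n : nat) :
  measurable_fun [set: n.-tuple R * R]
    (fun p => [tuple of rcons p.1 p.2] : (n.+1).-tuple R).
Proof.
apply/measurable_fun_tnthP => /= i.
have [ilt|ige] := ltnP i n.
  rewrite (_ : _ \o _ = fun p : n.-tuple R * R => tnth p.1 (Ordinal ilt)).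
    apply: (@measurableT_comp _ _ _ _ _ _ (fun t => tnth t (Ordinal ilt))) => //.
    exact: measurable_tnth.
  apply/funext => -[p q] /=.
  by rewrite (tnth_nth 0) /= nth_rcons size_tuple ilt (tnth_nth 0).
rewrite (_ : _ \o _ = snd); first exact: measurable_snd.
apply/funext => -[p q] /=.
have -> : i = ord_max by apply/val_inj/eqP; rewrite eqn_leq /= ige -ltnS ltn_ord.
by rewrite (tnth_nth 0) /= nth_rcons size_tuple ltnn eqxx.
Qed.

Section evalW_theory.
Variables (R : realType) (X : finType) (g : X -> R).
Variables (F : R -> X -> probability R R) (phi : rule X R).
Hypothesis g0 : forall x, 0 <= g x.
Hypothesis mphi : measurable_rule phi.
Implicit Types (C : R * R) (h : nat -> \bar R).
Local Open Scope ereal_scope.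

Lemma evalW_ge0 C h m k (xs : k.-tuple X) (ys : k.-tuple R) c :
  (forall n, 0 <= h n) -> 0 <= evalW g F phi C h m xs ys c.
Proof.
move=> h0; elim: m k xs ys c => [|m IH] k xs ys c //=.
apply: sume_ge0 => x _; apply: mule_ge0; first by rewrite lee_fin.
by apply: integral_ge0 => y _; exact: IH.
Qed.

(** The law of integration depends on [ys] through the chosen arm. With the arm fixed it is constant
    and Tonelli gives measurability; the two integrals are then glued along the measurable Boolean
    [phi xs x ys]. *)
Lemma measurable_evalW C h m k (xs : k.-tuple X) c : (forall n, 0 <= h n) ->
  measurable_fun [set: k.-tuple R] (fun ys => evalW g F phi C h m xs ys c).
Proof.
move=> h0; elim: m k xs c => [|m IH] k xs c /=.
  exact: measurable_cst.
apply: emeasurable_sum => x; apply: measurable_funeM.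
pose I a (ys : k.-tuple R) := \int[F (arm_param C a) x]_y
  evalW g F phi C h m [tuple of rcons xs x] [tuple of rcons ys y]
    (c + inferior F C x a).
have mI a : measurable_fun setT (I a).
  apply: (@measurable_fun_fubini_tonelli_F _ _ _ _ _ (F (arm_param C a) x)
    (fun p : k.-tuple R * R => evalW g F phi C h m [tuple of rcons xs x]
       [tuple of rcons p.1 p.2] (c + inferior F C x a))).
    exact: (measurableT_comp (IH _ _ _) (@measurable_rcons R k)).
  by move=> p; exact: evalW_ge0.
rewrite (_ : (fun ys => _) =
  fun ys => if phi xs x ys then I true ys else I false ys).
  by apply: measurable_fun_ifT => //; exact: mphi.
by apply/funext => ys; case: (phi xs x ys).
Qed.

Lemma measurable_evalW_rcons C h m k (xs : k.+1.-tuple X) (ys : k.-tuple R) c :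
  (forall n, 0 <= h n) ->
  measurable_fun [set: R]
    (fun y => evalW g F phi C h m xs [tuple of rcons ys y] c).
Proof.
move=> h0.
have := measurableT_comp (@measurable_rcons R k) (@measurable_pair1 _ _ _ _ ys).
move=> /(measurableT_comp (measurable_evalW C m xs c h0)); exact.
Qed.

Lemma le_evalW C h1 h2 m k (xs : k.-tuple X) (ys : k.-tuple R) c :
  (forall n, 0 <= h1 n) -> (forall n, h1 n <= h2 n) ->
  evalW g F phi C h1 m xs ys c <= evalW g F phi C h2 m xs ys c.
Proof.
move=> h0 h12; have h20 n : 0 <= h2 n by exact: le_trans (h12 n).
elim: m k xs ys c => [|m IH] k xs ys c //=.
apply: lee_sum => x _; apply: lee_wpmul2l; first by rewrite lee_fin.
apply: ge0_le_integral => //; [by move=> y _; exact: evalW_ge0|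
  exact: measurable_evalW_rcons..].
Qed.

Lemma evalWD C h1 h2 m k (xs : k.-tuple X) (ys : k.-tuple R) c :
  (forall n, 0 <= h1 n) -> (forall n, 0 <= h2 n) ->
  evalW g F phi C (fun n => h1 n + h2 n) m xs ys c =
  evalW g F phi C h1 m xs ys c + evalW g F phi C h2 m xs ys c.
Proof.
move=> h10 h20; elim: m k xs ys c => [|m IH] k xs ys c //=.
rewrite -big_split /=; apply: eq_bigr => x _.
rewrite -ge0_muleDr; [|by apply: integral_ge0 => y _; exact: evalW_ge0..].
rewrite -ge0_integralD //; [|by move=> y _; exact: evalW_ge0
  |exact: measurable_evalW_rcons|by move=> y _; exact: evalW_ge0
  |exact: measurable_evalW_rcons].
by congr (_ * _); apply: eq_integral => y _; exact: IH.
Qed.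

Lemma evalWZ C h (r : R) m k (xs : k.-tuple X) (ys : k.-tuple R) c :
  (0 <= r)%R -> (forall n, 0 <= h n) ->
  evalW g F phi C (fun n => r%:E * h n) m xs ys c =
  r%:E * evalW g F phi C h m xs ys c.
Proof.
move=> r0 h0; elim: m k xs ys c => [|m IH] k xs ys c //=.
rewrite ge0_sume_distrr; last first.
  move=> x _; apply: mule_ge0; first by rewrite lee_fin.
  by apply: integral_ge0 => y _; exact: evalW_ge0.
apply: eq_bigr => x _; rewrite muleCA; congr (_ * _).
rewrite -ge0_integralZl_EFin //.
- by apply: eq_integral => y _; exact: IH.
- by move=> y _; exact: evalW_ge0.
- exact: measurable_evalW_rcons.
Qed.

Lemma evalW_cst C (r : R) m k (xs : k.-tuple X) (ys : k.-tuple R) c :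
  (\sum_x g x = 1)%R -> evalW g F phi C (cst r%:E) m xs ys c = r%:E.
Proof.
move=> g1; elim: m k xs ys c => [|m IH] k xs ys c //=.
transitivity (\sum_x ((g x)%:E * r%:E)).
  apply: eq_bigr => x _; congr (_ * _).
  by under eq_integral do rewrite IH;
    rewrite integral_cst //= probability_setT mule1.
under eq_bigr do rewrite -EFinM.
by rewrite sumEFin -mulr_suml g1 mul1r.
Qed.

End evalW_theory.

(** * Truncation and exponential moments of integrable variables *)

Lemma expR_le_quadratic (R : realType) (w : R) :
  `|w| <= 2^-1 -> expR w <= 1 + w + 2 * w ^+ 2.
Proof.
rewrite ler_norml => /andP[w1 w2].
have e1 : 1 - w <= expR (- w) by exact: expR_ge1Dx.
have e0 : 0 < expR w by exact: expR_gt0.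
have e2 : expR w * expR (- w) = 1 by rewrite -expRD subrr expR0.
have : expR w * (1 - w) <= 1 by rewrite -[leRHS]e2 ler_pM2l.
(* The product equals [1 + w ^+ 2 * (1 - 2 * w)], and [w <= 1 / 2]. *)
have : 1 <= (1 + w + 2 * w ^+ 2) * (1 - w) by nra.
by move=> h1 h2; rewrite -(@ler_pM2r _ (1 - w)) //; lra.
Qed.

Section truncation.
Context d (T : measurableType d) (R : realType) (P : probability T R).
Implicit Types (z : T -> R) (M : R).

Definition excess M (w : R) : R := Num.max 0 (w - M).

Definition clamp M (w : R) : R := Num.min (Num.max w (- M)) M.

Lemma excess_ge0 M w : 0 <= excess M w.
Proof. by rewrite le_max lexx. Qed.

(** Values below [- M] are raised to [- M], so equality fails there; the inequality points the way
    needed to bound a log-likelihood ratio from above. *)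
Lemma le_clampDexcess M w : 0 <= M -> w <= clamp M w + excess M w.
Proof.
move=> M0; rewrite /clamp /excess minEle !maxEle.
by do 3 case: ifPn; rewrite -?ltNge => *; lra.
Qed.

Lemma clamp_norm M w : 0 <= M -> `|clamp M w| <= M.
Proof.
move=> M0; rewrite ler_norml /clamp minEle !maxEle.
by do 2 case: ifPn; rewrite -?ltNge => *; lra.
Qed.

(** The excess of the absolute value pays for raising values below [- M]. It lets the mean of the
    clamped variable be compared with the original mean. *)
Lemma clamp_le M w : 0 <= M -> clamp M w <= w + excess M `|w|.
Proof.
move=> M0; rewrite /clamp /excess minEle !maxEle.
by case: (ler0P w) => ?; do 3 case: ifPn; rewrite -?ltNge => *; lra.
Qed.

Lemma measurable_excess M : measurable_fun [set: R] (excess M).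
Proof.
apply: measurable_maxr; first exact: measurable_cst.
by apply: measurable_funB => //; exact: measurable_cst.
Qed.

Lemma measurable_clamp M : measurable_fun [set: R] (clamp M).
Proof.
apply: measurable_minr; last exact: measurable_cst.
by apply: measurable_maxr => //; exact: measurable_cst.
Qed.

Local Open Scope ereal_scope.

(** Dominated convergence with the absolute value of [z] as bound: at each point the excess vanishes
    once [n] reaches that value. *)
Lemma excess_norm_cvg z : P.-integrable setT (EFin \o z) ->
  \int[P]_y (excess n%:R `|z y|)%:E @[n --> \oo] --> 0.
Proof.
move=> iz; have mz : measurable_fun setT z.
  by apply/measurable_EFinP; exact: measurable_int iz.
have iabs : P.-integrable setT (fun y => `|(z y)%:E|) by exact: integrable_abse.
have me n : measurable_fun setT (fun y => (excess n%:R `|z y|)%:E).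
  apply/measurable_EFinP/measurableT_comp; first exact: measurable_excess.
  exact: measurableT_comp.
have [||||] // := @dominated_convergence _ _ _ P _ measurableT
  (fun n y => (excess n%:R `|z y|)%:E) (cst 0) (fun y => `|(z y)%:E|) me.
- apply: aeW => y _; apply: cvg_near_cst.
  near=> n; congr EFin; rewrite /excess; apply/max_idPl.
  by rewrite subr_le0; near: n; exact: nbhs_infty_ger.
- apply: aeW => y n _ /=.
  rewrite lee_fin ger0_norm ?excess_ge0 // /excess ge_max normr_ge0 /=.
  by rewrite gerBl.
- by move=> _ _; rewrite integral0.
Unshelve. all: by end_near. Qed.

Lemma integrable_excess_norm z M : (0 <= M)%R -> P.-integrable setT (EFin \o z) ->
  P.-integrable setT (fun y => (excess M `|z y|)%:E).
Proof.
move=> M0 iz; have mz : measurable_fun setT z.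
  by apply/measurable_EFinP; exact: measurable_int iz.
apply: (le_integrable _ _ _ iz) => //.
  apply/measurable_EFinP/measurableT_comp; first exact: measurable_excess.
  exact: measurableT_comp.
move=> y _ /=; rewrite lee_fin ger0_norm ?excess_ge0 //.
by rewrite /excess ge_max normr_ge0 gerBl.
Qed.

(** As [l * M <= 1 / 2], the quadratic bound on [expR] applies. Its linear term integrates to at
    most [l * (k + e)] by [clamp_le], and [1 + s <= expR s] restores the exponential form. *)
Lemma clamp_mgf_le z M (k e l : R) : (0 <= M)%R -> (0 <= l)%R ->
  (l * M <= 2^-1)%R -> P.-integrable setT (EFin \o z) ->
  \int[P]_y (z y)%:E <= k%:E -> \int[P]_y (excess M `|z y|)%:E <= e%:E ->
  \int[P]_y (expR (l * clamp M (z y)))%:E <=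
    (expR (l * (k + e) + 2 * (l * M) ^+ 2))%:E.
Proof.
move=> M0 l0 lM iz zk ze; have mz : measurable_fun setT z.
  by apply/measurable_EFinP; exact: measurable_int iz.
have ie := integrable_excess_norm M0 iz.
pose a : R := (1 + 2 * (l * M) ^+ 2)%R.
pose u y := (z y)%:E + (excess M `|z y|)%:E.
have iu : P.-integrable setT u by exact: integrableD.
have ilu : P.-integrable setT (fun y => l%:E * u y) by exact: integrableZl.
have ia : P.-integrable setT (cst a%:E) by exact: finite_measure_integrable_cst.
apply: (@le_trans _ _ (\int[P]_y (a%:E + l%:E * u y))).
  apply: ge0_le_integral => //.
  - apply/measurable_EFinP; apply: measurableT_comp => //.
    apply: measurable_funM; first exact: measurable_cst.
    by apply: measurableT_comp => //; exact: measurable_clamp.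
  - by apply: emeasurable_funD; [exact: measurable_cst|exact: measurable_int ilu].
  move=> y _; rewrite (_ : a%:E + _ =
    (a + l * (z y + excess M `|z y|))%:E) // lee_fin.
  have c1 := @clamp_norm M (z y) M0; have c2 := @clamp_le M (z y) M0.
  have w1 : (`|l * clamp M (z y)| <= l * M)%R.
    by rewrite normrM (ger0_norm l0); exact: ler_wpM2l.
  apply: le_trans (@expR_le_quadratic R _ (le_trans w1 lM)) _.
  have w2 : (l * clamp M (z y) <= l * (z y + excess M `|z y|))%R by exact: ler_wpM2l.
  have : ((l * clamp M (z y)) ^+ 2 <= (l * M) ^+ 2)%R.
    by rewrite -[leLHS]real_normK ?num_real // lerXn2r // nnegrE mulr_ge0.
  by rewrite /a; lra.
rewrite integralD // integralZl // integralD // integral_cst //=.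
rewrite probability_setT mule1.
apply: (@le_trans _ _ (a%:E + l%:E * (k%:E + e%:E))).
  by apply: leeD => //; apply: lee_wpmul2l; rewrite ?lee_fin //; exact: leeD.
rewrite (_ : a%:E + _ = (a + l * (k + e))%:E) // lee_fin /a.
apply: le_trans (expR_ge1Dx _); lra.
Qed.

End truncation.

(** * Log-likelihood ratio and change of measure *)

Section log_likelihood.
Variables (R : realType) (P Q : probability R R).
Local Open Scope ereal_scope.

(** The log-likelihood ratio, written exactly as the integrand of [KL]. *)
Definition llr (y : R) : R :=
  ln (fine (charge.Radon_Nikodym (charge_of_finite_measure P) Q y)).

Lemma measurable_llr : P `<< Q -> measurable_fun [set: R] llr.
Proof.
by move=> PQ; do 2 apply: measurableT_comp => //.
Qed.

(** The integral is the difference of the integrals of the positive and negative parts, and such a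
    difference is finite only if both are. Their sum is the integral of the absolute value. *)
Lemma KL_fin_num : KL P Q \is a fin_num ->
  [/\ P `<< Q, P.-integrable setT (EFin \o llr) &
      KL P Q = \int[P]_y (llr y)%:E].
Proof.
rewrite /KL; case: pselect => // PQ fin.
have mz := measurable_llr PQ.
split => //; apply/integrableP; split; first exact/measurable_EFinP.
move: fin; rewrite integralE fin_numB => /andP[fp fn].
rewrite (_ : (fun _ => _) = (EFin \o llr)^\+ \+ (EFin \o llr)^\-); last first.
  by rewrite -fune_abse.
rewrite ge0_integralD //.
- by rewrite lte_add_pinfty // ltey_eq ?fp ?fn.
- by apply: measurable_funepos; exact/measurable_EFinP.
- by apply: measurable_funeneg; exact/measurable_EFinP.
Qed.

(** As a [Q]-integral the left side carries the density, which [expR (- llr y)] cancels wherever it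
    is positive. Where it vanishes the integrand is 0, whence an inequality rather than an
    equality. *)
Lemma change_of_measure_le (B : R -> \bar R) : P `<< Q ->
  measurable_fun setT B -> (forall y, 0 <= B y) ->
  \int[P]_y ((expR (- llr y))%:E * B y) <= \int[Q]_y B y.
Proof.
move=> PQ mB B0.
have mw : measurable_fun setT (fun y => (expR (- llr y))%:E * B y).
  apply: emeasurable_funM => //; apply/measurable_EFinP.
  by do 2 apply: measurableT_comp => //; exact: measurable_llr.
have w0 y : 0 <= (expR (- llr y))%:E * B y.
  by rewrite mule_ge0 // lee_fin expR_ge0.
rewrite -(Radon_Nikodym_SigmaFinite.change_of_variables PQ) //.
have f0 := @Radon_Nikodym_SigmaFinite.f_ge0 _ _ _ P Q PQ.
have ffin := @Radon_Nikodym_SigmaFinite.f_fin_num _ _ _ P Q PQ.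
apply: ae_ge0_le_integral => //.
- by move=> y _; exact: mule_ge0.
- apply: emeasurable_funM => //.
  exact: measurable_int (Radon_Nikodym_SigmaFinite.f_integrable PQ).
have := ae_eq_Radon_Nikodym_SigmaFinite PQ measurableT.
apply: filterS => y /= /(_ I) eqf _.
rewrite muleAC -[leRHS]mul1e; apply: lee_wpmul2r => //.
rewrite /llr -eqf -(fineK (ffin y)) -EFinM lee_fin /=.
move: (f0 y); rewrite -{1}(fineK (ffin y)) lee_fin le_eqVlt.
move=> /predU1P[<-|fpos]; first by rewrite mulr0.
by rewrite expRN lnK // mulVf // gt_eqF.
Qed.

End log_likelihood.

(** * Transfer of a bound from one configuration to another *)

Section change_of_configuration.
Variables (R : realType) (X : finType) (g : X -> R).
Variables (F : R -> X -> probability R R) (phi : rule X R).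
Hypothesis g0 : forall x, 0 <= g x.
Hypothesis g1 : \sum_x g x = 1.
Hypothesis mphi : measurable_rule phi.
Variables (a : bool) (C C' : R * R).
Hypothesis armE : arm_param C' (~~ a) = arm_param C (~~ a).
Hypothesis infC : forall x b, inferior F C x b = (b == a).
Hypothesis infC' : forall x b, inferior F C' x b = (b == ~~ a).
Local Notation P x := (F (arm_param C a) x).
Local Notation Q x := (F (arm_param C' a) x).
Hypothesis PQ : forall x, P x `<< Q x.
Variables (M lam psi eta D1 D2 : R) (N t : nat).
Hypotheses (M0 : 0 <= M) (lam0 : 0 <= lam) (eta0 : 0 <= eta) (psi0 : 0 <= psi) (D20 : 0 < D2).
Hypothesis Nt : (N < t)%N.
Hypothesis mgfP : forall x, (\int[P x]_y
  (expR (lam * clamp M (llr (P x) (Q x) y)))%:E <= (expR psi)%:E)%E.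
Hypothesis excessP : forall x, (\int[P x]_y
  (excess M (llr (P x) (Q x) y))%:E <= eta%:E)%E.

Local Notation few := (fun n => if (n < N)%N then 1%E else 0%E).
Local Notation cnt := (fun n => n%:R%:E).

Let few0 n : (0 <= few n :> \bar R)%E.
Proof. by rewrite /=; case: ifP. Qed.

Let cnt0 n : (0 <= cnt n :> \bar R)%E.
Proof. by rewrite lee_fin. Qed.

Let evalW_few_eq0 m k (xs : k.-tuple X) (ys : k.-tuple R) c : (N <= c)%N ->
  evalW g F phi C few m xs ys c = 0%E.
Proof.
elim: m k xs ys c => [|m IH] k xs ys c Nc /=; first by rewrite ltnNge Nc.
apply: big1 => x _; rewrite [X in (_ * X)%E]integral0_eq ?mule0 // => y _.
by apply: IH; rewrite (leq_trans Nc) // leq_addr.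
Qed.

(** The likelihood factor, normalised by [t - N]: if [u + v <= D1 + D2] at the horizon, its product
    with a final count of at least [t - N] is at least 1. *)
Local Notation weight u v := (expR (D1 + D2 - u - v) / (t - N)%:R).
(** Controls the event that [u] ends above [D1] (exponential Markov bound) or [v] above [D2] (Markov
    bound). Here [r] counts the plays of [a] left before [N]; each costs a factor [expR psi] and a
    term [eta]. *)
Local Notation bad u v r :=
  (expR (lam * (u - D1) + r%:R * psi) + (v + r%:R * eta) / D2).

Let weight_ge0 (u v : R) : 0 <= weight u v.
Proof. by rewrite divr_ge0 // expR_ge0. Qed.

Let bad_ge0 (u v : R) (r : nat) : 0 <= v -> 0 <= bad u v r.
Proof.
move=> v0; rewrite addr_ge0 ?expR_ge0 // divr_ge0 ?(ltW D20) //.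
by rewrite addr_ge0 // mulr_ge0.
Qed.

Local Open Scope ereal_scope.

(* Here [u] and [v] stand for the clamped and the excess part of the
   log-likelihood ratio accumulated so far along the history [xs], [ys]. *)
Lemma evalW_change_of_configuration m k (xs : k.-tuple X) (ys : k.-tuple R)
    c c' (u v : R) : (0 <= v)%R -> (c + c' + m = t)%N ->
  evalW g F phi C few m xs ys c <=
    (weight u v)%R%:E * evalW g F phi C' cnt m xs ys c' +
    (bad u v (N - c)%N)%R%:E.
Proof.
elim: m k xs ys c c' u v => [|m IH] k xs ys c c' u v v0 cct;
  have [Nc|cN] := leqP N c.
- rewrite evalW_few_eq0 //; apply: adde_ge0; last by rewrite lee_fin bad_ge0.
  by apply: mule_ge0; [rewrite lee_fin|exact: evalW_ge0].
(* At the horizon [c < N] forces [c' >= t - N]. Either [u + v <= D1 + D2] and the first term is at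
   least 1, or one of [u > D1], [v > D2] holds and the matching summand of [bad] is at least 1. *)
- rewrite /= cN -EFinM -EFinD lee_fin.
  have tN0 : (0 < (t - N)%:R :> R)%R by rewrite ltr0n subn_gt0.
  have tNc' : ((t - N)%:R <= c'%:R :> R)%R by rewrite ler_nat; lia.
  have r0 : (0 <= (N - c)%:R * eta)%R by rewrite mulr_ge0.
  have b2 : (0 <= (v + (N - c)%:R * eta) / D2)%R.
    by rewrite divr_ge0 ?addr_ge0 // ltW.
  have b1 : (0 <= expR (lam * (u - D1) + (N - c)%:R * psi))%R by exact: expR_ge0.
  have w1 : (0 <= (weight u v) * c'%:R)%R by rewrite mulr_ge0.
  have [uv|uv] := leP (u + v)%R (D1 + D2)%R.
    suff : (1 <= weight u v * c'%:R)%R by lra.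
    rewrite mulrAC ler_pdivlMr // mul1r.
    apply: le_trans tNc' _; rewrite ler_peMl // -expR0 ler_expR; lra.
  have [uD|uD] := leP u D1.
    suff : (1 <= (v + (N - c)%:R * eta) / D2)%R by lra.
    by rewrite ler_pdivlMr // mul1r; lra.
  suff : (1 <= expR (lam * (u - D1) + (N - c)%:R * psi))%R by lra.
  rewrite -[leLHS]expR0 ler_expR addr_ge0 // mulr_ge0 //; lra.
- rewrite evalW_few_eq0 //; apply: adde_ge0; last by rewrite lee_fin bad_ge0.
  by apply: mule_ge0; [rewrite lee_fin|exact: evalW_ge0].
have ct1 : (c + c'.+1 + m = t)%N by rewrite addnS addSnnS.
have ct2 : (c.+1 + c' + m = t)%N by rewrite !addSn -addnS.
have NcE : (N - c = (N - c.+1).+1)%N by rewrite -subSn // subSS.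
set W := (bad u v (N - c)%N)%R; set w := (weight u v)%R.
have W0 : (0 <= W)%R by exact: bad_ge0.
have w0 : (0 <= w)%R by exact: weight_ge0.
(* It suffices to argue for each [x] separately: [W] does not depend on [x] and the weights [g x]
   sum to 1. *)
suff key x : \int[F (arm_param C (phi xs x ys)) x]_y
      evalW g F phi C few m [tuple of rcons xs x] [tuple of rcons ys y]
        (c + inferior F C x (phi xs x ys)) <=
    w%:E * \int[F (arm_param C' (phi xs x ys)) x]_y
      evalW g F phi C' cnt m [tuple of rcons xs x] [tuple of rcons ys y]
        (c' + inferior F C' x (phi xs x ys)) + W%:E.
  rewrite /= ge0_sume_distrr; last first.
    move=> x _; apply: mule_ge0; first by rewrite lee_fin.
    by apply: integral_ge0 => y _; exact: evalW_ge0.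
  have -> : W%:E = \sum_x (g x)%:E * W%:E.
    by under eq_bigr do rewrite -EFinM; rewrite sumEFin -mulr_suml g1 mul1r.
  rewrite -big_split /=; apply: lee_sum => x _.
  rewrite muleCA -ge0_muleDr; last 2 first.
  - apply: mule_ge0; first by rewrite lee_fin.
    by apply: integral_ge0 => y _; exact: evalW_ge0.
  - by rewrite lee_fin.
  by apply: lee_wpmul2l; rewrite ?lee_fin.
(* If the other arm is played, its law is the same under both configurations, so [u] and [v] stay
   unchanged and only [c'] grows. *)
rewrite infC infC'; have [->|] := eqVneq (phi xs x ys) a; last first.
  move=> dE; have -> : phi xs x ys = ~~ a.
    by apply/eqP; move: dE; case: (phi _ _ _) (a) => -[].
  rewrite eqxx addn0 addn1 armE; set mu := F _ _.
  apply: (@le_trans _ _ (\int[mu]_y (w%:E * evalW g F phi C' cnt m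
     [tuple of rcons xs x] [tuple of rcons ys y] c'.+1 + W%:E))).
    apply: ge0_le_integral => //.
    - by move=> y _; exact: evalW_ge0.
    - exact: measurable_evalW_rcons.
    - apply: emeasurable_funD; last exact: measurable_cst.
      by apply: measurable_funeM; exact: measurable_evalW_rcons.
    by move=> y _; exact: IH.
  rewrite ge0_integralD //; last 2 first.
  - by move=> y _; apply: mule_ge0; [rewrite lee_fin|exact: evalW_ge0].
  - by apply: measurable_funeM; exact: measurable_evalW_rcons.
  rewrite ge0_integralZl_EFin //; last 2 first.
  - by move=> y _; exact: evalW_ge0.
  - exact: measurable_evalW_rcons.
  by rewrite integral_cst //= probability_setT mule1.
(* Arm [a] is played: [c] grows, so the induction hypothesis comes with one play fewer in [bad],
   which leaves a factor [expR psi] and a term [eta] to spend. *)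
rewrite addn1.
have -> : (a == ~~ a) = false by case: (a).
rewrite addn0.
set B := fun y => evalW g F phi C' cnt m [tuple of rcons xs x]
  [tuple of rcons ys y] c'.
have B0 y : 0 <= B y by exact: evalW_ge0.
have mB : measurable_fun setT B by exact: measurable_evalW_rcons.
pose z := llr (P x) (Q x); have mz : measurable_fun setT z by exact: measurable_llr.
pose r := (N - c.+1)%:R : R.
have rE : ((N - c)%:R = 1 + r :> R)%R by rewrite /r nat1r; rewrite NcE.
pose b1 := expR (lam * (u - D1) + r * psi).
pose b2 := ((v + r * eta) / D2)%R.
have b20 : (0 <= b2)%R by rewrite divr_ge0 ?addr_ge0 ?mulr_ge0 // ltW.
pose f1 y := (expR (- z y))%:E * B y.
pose f2 y := (expR (lam * clamp M (z y)))%:E.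
pose f3 y := (excess M (z y))%:E.
have f10 y : 0 <= f1 y by rewrite mule_ge0 // lee_fin expR_ge0.
have f20 y : 0 <= f2 y by rewrite lee_fin expR_ge0.
have f30 y : 0 <= f3 y by rewrite lee_fin excess_ge0.
have mf1 : measurable_fun setT f1.
  apply: emeasurable_funM => //; apply/measurable_EFinP.
  by do 2 apply: measurableT_comp => //.
have mf2 : measurable_fun setT f2.
  apply/measurable_EFinP; apply: measurableT_comp => //.
  apply: measurable_funM; first exact: measurable_cst.
  by apply: measurableT_comp => //; exact: measurable_clamp.
have mf3 : measurable_fun setT f3.
  by apply/measurable_EFinP; apply: measurableT_comp => //; exact: measurable_excess.
have b10 : (0 <= b1)%R by exact: expR_ge0.
have D2V0 : (0 <= D2^-1)%R by rewrite invr_ge0 ltW.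
(* The induction hypothesis is taken at [u + clamp M (z y)] and [v + excess M (z y)]. By
   [le_clampDexcess] the new weight is at most [w] times [expR (- z y)]. *)
apply: (@le_trans _ _ (\int[P x]_y
    (w%:E * f1 y + (b1%:E * f2 y + (D2^-1%:E * f3 y + b2%:E))))).
  apply: ge0_le_integral => //.
  - by move=> y _; exact: evalW_ge0.
  - exact: measurable_evalW_rcons.
  - by do 3 (apply: emeasurable_funD; first exact: measurable_funeM);
      exact: measurable_cst.
  move=> y _.
  apply: (le_trans (IH _ _ _ _ c' (u + clamp M (z y))%R (v + excess M (z y))%R
    _ _)); [by rewrite addr_ge0 ?excess_ge0|exact: ct2|].
  rewrite /f1 muleA -EFinM; apply: leeD.
    apply: lee_wpmul2r; first exact: B0.
    rewrite lee_fin /w mulrAC.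
    rewrite -expRD ler_pM2r ?invr_gt0 ?ltr0n ?subn_gt0 // ler_expR.
    have := @le_clampDexcess _ M (z y) M0; lra.
  rewrite /f2 /f3 -!EFinM -!EFinD lee_fin  -/r /b1 /b2 -expRD.
  rewrite le_eqVlt; apply/orP; left; apply/eqP; congr (expR _ + _)%R; lra.
have s1 y : 0 <= w%:E * f1 y by rewrite mule_ge0 ?lee_fin.
have s2 y : 0 <= b1%:E * f2 y by rewrite mule_ge0.
have s3 y : 0 <= D2^-1%:E * f3 y by rewrite mule_ge0.
have s4 y : 0 <= D2^-1%:E * f3 y + b2%:E by rewrite adde_ge0.
have s5 y : 0 <= b1%:E * f2 y + (D2^-1%:E * f3 y + b2%:E) by rewrite adde_ge0.
rewrite !ge0_integralD //; do ?[exact: measurable_funeM |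
  by repeat (apply: emeasurable_funD); do ?[exact: measurable_funeM];
     exact: measurable_cst].
rewrite !ge0_integralZl_EFin // integral_cst //= probability_setT mule1.
(* The three integrals are bounded by the change of measure, by [expR psi] and by [eta]; the last
   two restore the play missing from [r]. *)
apply: leeD.
  by apply: lee_wpmul2l; [rewrite lee_fin|exact: change_of_measure_le].
apply: (@le_trans _ _ (b1%:E * (expR psi)%:E + (D2^-1%:E * eta%:E + b2%:E))).
  apply: leeD; first by apply: lee_wpmul2l; [rewrite lee_fin|exact: mgfP].
  by apply: leeD => //; apply: lee_wpmul2l; [rewrite lee_fin|exact: excessP].
rewrite -!EFinM -!EFinD lee_fin /W  rE /b1 /b2 -expRD.
rewrite le_eqVlt; apply/orP; left; apply/eqP; congr (expR _ + _)%R; lra.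
Qed.

(** The induction is started at the empty history, with both counts and [u], [v] equal to 0. *)
Lemma E_Tinf_few_le : E_Tinf g F phi C few t <=
  (expR (D1 + D2) / (t - N)%:R)%:E * mean_Tinf g F phi C' t +
  (expR (N%:R * psi - lam * D1) + N%:R * eta / D2)%:E.
Proof.
apply: (le_trans (@evalW_change_of_configuration t 0 [tuple] [tuple] 0 0 0 0 _ _)).
- by [].
- by [].
rewrite !subr0 sub0r subn0 add0r mulrN.
by rewrite (addrC (- (lam * D1))%R).
Qed.

End change_of_configuration.

(** * Eventual bounds and limits inferior *)

Lemma near_ln_ge (R : realType) (L : R) : \forall t \near \oo, L <= ln t%:R.
Proof.
near=> t; have tL : expR L <= t%:R by near: t; exact: nbhs_infty_ger.
by rewrite -[leLHS]expRK ler_ln ?posrE ?(lt_le_trans _ tL) ?expR_gt0.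
Unshelve. all: by end_near. Qed.

Lemma limn_einf_ge (R : realType) (u : (\bar R)^nat) (c : \bar R) :
  (\forall n \near \oo, c <= u n)%E -> (c <= limn_einf u)%E.
Proof.
move=> [n0 _ cu]; rewrite limn_einf_lim; apply: lime_ge.
  exact: is_cvg_einfs.
near=> n; apply/ereal_infP => _ [m /= nm <-]; apply: cu => /=.
apply: leq_trans nm; near: n; exact: nbhs_infty_ge.
Unshelve. all: by end_near. Qed.

Definition set_arm (R : realType) (C : R * R) (a : bool) (th : R) : R * R :=
  if a then (C.1, th) else (th, C.2).

(** * Rarity of few inferior plays under a uniformly good rule *)

Section lower_bound.
Variables (R : realType) (X : finType) (Theta : set R) (g : X -> R).
Variables (F : R -> X -> probability R R) (phi : rule X R).
Hypothesis g_ge0 : forall x, 0 <= g x.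
Hypothesis g1 : \sum_x g x = 1.
Hypothesis KLfin : forall th vth, Theta th -> Theta vth -> th != vth ->
  forall x : X, (0 < KLx F th vth x < +oo)%E.
Hypothesis mean_mono : forall (x : X) th th', Theta th -> Theta th' ->
  th < th' -> mean F th x < mean F th' x.
Hypothesis mphi : measurable_rule phi.
Hypothesis good : uniformly_good Theta g F phi.

(** Strict monotonicity of the means makes the comparison of the arms the same for every [x]. *)
Lemma inferiorE C a : Theta (arm_param C a) -> Theta (arm_param C (~~ a)) ->
  arm_param C a < arm_param C (~~ a) ->
  forall x b, inferior F C x b = (b == a).
Proof.
move=> Ta Tn aln x b; have lt := mean_mono x Ta Tn aln.
rewrite /inferior; have [->//|ba] := eqVneq b a.
have -> : b = ~~ a by apply/eqP; move: ba; case: (b) (a) => -[].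
by rewrite negbK; apply/negbTE; rewrite -leNgt ltW.
Qed.

(** Each [x] has a level by [excess_norm_cvg]; as [X] is finite, one level serves all of them. *)
Lemma truncation_level (th vth eta : R) :
  Theta th -> Theta vth -> th != vth -> 0 < eta ->
  exists2 M : R, 0 <= M & forall x,
    (\int[F th x]_y (excess M `|llr (F th x) (F vth x) y|)%:E <= eta%:E)%E.
Proof.
move=> Tth Tvth tv eta0.
have : \forall n \near \oo, forall x, (\int[F th x]_y
    (excess n%:R `|llr (F th x) (F vth x) y|)%:E < eta%:E)%E.
  apply: filter_forall => x.
  have KLf : KL (F th x) (F vth x) \is a fin_num.
    have /andP[K0 Koo] := KLfin Tth Tvth tv x.
    by rewrite ge0_fin_numE // ltW.
  have [_ iz _] := KL_fin_num KLf.
  have /(_ [set y | (y < eta%:E)%E]) := excess_norm_cvg iz.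
  by apply; exact: (@nbhs_open_ereal_lt _ 0 (fun=> eta)).
by case=> n _ /(_ n (leqnn n)) h; exists n%:R => // x; exact: ltW.
Qed.

(** The free constants of [E_Tinf_few_le] are chosen so that each of its three terms is eventually
    at most [d / 3]. *)
Lemma E_Tinf_lt_small (a : bool) (C : R * R) (th k e d : R) :
  Theta (arm_param C a) -> Theta (arm_param C (~~ a)) -> Theta th ->
  arm_param C a < arm_param C (~~ a) -> arm_param C (~~ a) < th ->
  (forall x, (KLx F (arm_param C a) th x <= k%:E)%E) ->
  0 < k -> 0 < e < 1 -> 0 < d ->
  \forall t \near \oo, (E_Tinf g F phi C
    (fun c => if (c%:R < (1 - e) * ln (t%:R : R) / k)%R then 1 else 0) t
      <= d%:E)%E.
Proof.
move=> Ta Tn Tth aln nlth KLk k0 /andP[e0 e1] d0.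
pose C' := set_arm C a th.
have armC'a : arm_param C' a = th by rewrite /C'; case: (a).
have armC'n : arm_param C' (~~ a) = arm_param C (~~ a) by rewrite /C'; case: (a).
have infC := inferiorE Ta Tn aln.
have infC' : forall x b, inferior F C' x b = (b == ~~ a).
  by apply: inferiorE; rewrite ?negbK ?armC'a ?armC'n.
have ath : arm_param C a != th by rewrite lt_eqF // (lt_trans aln).
have ke0 : 0 < k * e by exact: mulr_gt0.
(* The first bound keeps [psi] close to [lam * k]; the second makes the Markov term at most
   [d / 3]. *)
pose eta := Num.min (k * e / 8) (k * e * d / 24).
have eta0 : 0 < eta by rewrite lt_min !divr_gt0 ?mulr_gt0.
have [eta1 eta2] : eta <= k * e / 8 /\ eta <= k * e * d / 24.
  by rewrite /eta !ge_min !lexx orbT.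
have [M M0 Meta] := truncation_level Ta Tth ath eta0.
(* The first bound gives [lam * M <= 1 / 2], the second makes the quadratic term of [psi] at most
   [lam * (k * e / 8)]. [M + 1] avoids a division by 0. *)
pose lam := Num.min ((2 * (M + 1))^-1) (k * e / (16 * (M + 1) ^+ 2)).
have M1 : 0 < M + 1 by lra.
have lam0 : 0 < lam.
  by rewrite lt_min invr_gt0 divr_gt0 ?mulr_gt0 ?exprn_gt0 // mulr_gt0.
have [lam1 lam2] : lam * M <= 2^-1 /\ 2 * (lam * M ^+ 2) <= k * e / 8.
  have l1 : lam * (2 * (M + 1)) <= 1.
    by rewrite -ler_pdivlMr ?mulr_gt0 // div1r /lam ge_min lexx.
  have l2 : lam * (16 * (M + 1) ^+ 2) <= k * e.
    by rewrite -ler_pdivlMr ?mulr_gt0 ?exprn_gt0 // /lam ge_min lexx orbT.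
  split; first by lra.
  have : lam * M ^+ 2 <= lam * (M + 1) ^+ 2.
    by rewrite ler_pM2l // lerXn2r ?nnegrE; lra.
  lra.
pose psi := lam * (k + eta) + 2 * (lam * M) ^+ 2.
have psi0 : 0 <= psi.
  by rewrite addr_ge0 ?mulr_ge0 ?sqr_ge0 // ?addr_ge0 // ltW.
have psi1 : psi <= lam * (k * (1 + e / 4)).
  rewrite /psi exprMn expr2 -[lam * lam * _]mulrA mulrCA -mulrDr ler_pM2l //.
  lra.
have KLf x : KL (F (arm_param C a) x) (F th x) \is a fin_num.
  by have /andP[K0 Koo] := KLfin Ta Tth ath x; rewrite ge0_fin_numE // ltW.
(* The exponent [e / 4] is the gap between [D1 + D2 = (1 - e / 4) * ln t], fixed below, and
   [ln t]. *)
have small : \forall t \near \oo,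
    (mean_Tinf g F phi C' t / ((t%:R `^ (e / 4) : R)%:E) < (d / 6)%:E)%E.
  have [T1 T2] : Theta C'.1 /\ Theta C'.2.
    by rewrite /C' /set_arm; move: Ta Tn; rewrite /arm_param; case: (a).
  have e40 : 0 < e / 4 by rewrite divr_gt0.
  have /(_ [set y | (y < (d / 6)%:E)%E]) := good T1 T2 e40.
  by apply; apply: (@nbhs_open_ereal_lt _ 0 (fun=> d / 6)); rewrite divr_gt0.
near=> t.
(* [l1] serves [T3], [l2] serves [2 * N <= t], and [l3] serves [T2]. *)
have l1 : k <= ln (t%:R : R) by near: t; exact: near_ln_ge.
have l2 : 4 / k + 2 <= ln (t%:R : R) by near: t; exact: near_ln_ge.
have l3 : (psi - ln (d / 3)) * 4 / (lam * e) <= ln (t%:R : R).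
  by near: t; exact: near_ln_ge.
have t0 : 0 < t%:R :> R by rewrite ltr0n; near: t; exact: nbhs_infty_gt.
have smallt : (mean_Tinf g F phi C' t / ((t%:R `^ (e / 4) : R)%:E) < (d / 6)%:E)%E.
  by near: t.
set l := ln (t%:R : R) in l1 l2 l3 *.
have l0 : 0 < l by exact: lt_le_trans l1.
have tE : expR l = t%:R by rewrite /l lnK.
pose x := (1 - e) * l / k.
have x0 : 0 <= x by rewrite divr_ge0 ?mulr_ge0 ?subr_ge0 // ltW.
have xl : x <= l / k.
  by rewrite /x -mulrA ler_piMl ?divr_ge0 ?(ltW l0) ?(ltW k0) //; lra.
(* The least integer above [x], so that [c < x] implies [c < N]. *)
pose N := (Num.truncn x).+1.
have /andP[tx xN] := truncn_itv x0.
have Nx : N%:R <= x + 1 :> R by rewrite /N -natr1 lerD2r.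
(* This follows from [t = expR l >= 1 + l ^+ 2 / 2] together with [l2]. *)
have N2t : 2 * N%:R <= t%:R :> R.
  have := @expR_ge1Dxn R l 1 (ltW l0); rewrite tE => tl.
  have : l / k * 4 + 2 * l <= l ^+ 2.
    rewrite expr2 -mulrA [_^-1 * 4]mulrC (mulrC 2) -mulrDr ler_pM2l //.
  have : 0 < 4 / k by rewrite divr_gt0.
  move: tl; rewrite (_ : 2`!%:R = 2 :> R) //; lra.
have Nt : (N < t)%N by rewrite -(ltr_nat R); lra.
have N2 : 0 < (t - N)%:R :> R by rewrite ltr0n subn_gt0.
have mean'le : (mean_Tinf g F phi C' t <= (d / 6 * expR (e / 4 * l))%:E)%E.
  have p0 : (0 < expR (e / 4 * l))%R by exact: expR_gt0.
  move: smallt; rewrite /powR gt_eqF // -/l => /ltW.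
  by rewrite inver gt_eqF // lee_pdivrMr // -EFinM.
have lt_few c : c%:R < x -> (c < N)%N.
  by move=> cx; rewrite -(ltr_nat R) (lt_trans cx).
apply: (@le_trans _ _ (E_Tinf g F phi C (fun n => if (n < N)%N then 1 else 0) t)%E).
  apply: le_evalW => // n; first by case: ifP.
  by rewrite -/l -/x; case: ifPn => [/lt_few -> //|_]; case: ifP.
(* [D1] exceeds the mean drift, at most about [(1 - 3 / 4 * e) * l], while [D1 + D2] stays a margin
   [e / 4 * l] below [l]. *)
pose D1 := (1 - e / 2) * l; pose D2 := e / 4 * l.
have D20 : 0 < D2 by rewrite mulr_gt0 ?divr_gt0.
apply: (le_trans (@E_Tinf_few_le R X g F phi g_ge0 g1 mphi a C C' armC'n infC infC'
  _ M lam psi eta D1 D2 N t M0 (ltW lam0) (ltW eta0) psi0 D20 Nt _ _)).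
- by move=> y; rewrite armC'a; have [] := KL_fin_num (KLf y).
- move=> y; rewrite armC'a; have [PQ iz zE] := KL_fin_num (KLf y).
  apply: clamp_mgf_le => //; first exact: ltW.
  by rewrite -zE; exact: KLk.
- move=> y; rewrite armC'a; have [PQ iz zE] := KL_fin_num (KLf y).
  apply: le_trans (Meta y); have mz := measurable_llr PQ.
  apply: ge0_le_integral => //.
  + by move=> u _; rewrite lee_fin excess_ge0.
  + by apply/measurable_EFinP; apply: measurableT_comp => //; exact: measurable_excess.
  + apply/measurable_EFinP; apply: measurableT_comp; first exact: measurable_excess.
    exact: measurableT_comp.
  by move=> u _; rewrite lee_fin /excess ge_max !le_max lexx /= lerB ?ler_norm ?orbT.
have w0 : 0 <= expR (D1 + D2) / (t - N)%:R by rewrite divr_ge0 ?expR_ge0.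
apply: (@le_trans _ _ ((expR (D1 + D2) / (t - N)%:R * (d / 6 * expR (e / 4 * l)))%:E +
   (expR (N%:R * psi - lam * D1) + N%:R * eta / D2)%:E)%E).
  by apply: leeD => //; rewrite [leRHS]EFinM; apply: lee_wpmul2l; rewrite ?lee_fin.
rewrite -EFinD lee_fin.
(* The exponents add up to [l], leaving [d / 6 * t / (t - N)], and [2 * N <= t]. *)
have T1 : expR (D1 + D2) / (t - N)%:R * (d / 6 * expR (e / 4 * l)) <= d / 3.
  rewrite mulrAC ler_pdivrMr // mulrCA -expRD.
  rewrite (_ : D1 + D2 + e / 4 * l = l) ?tE; last by rewrite /D1 /D2; lra.
  rewrite natrB ?(ltnW Nt) //.
  have : d * (2 * N%:R) <= d * t%:R by rewrite ler_pM2l.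
  lra.
(* Up to the constant [psi], the exponent is at most [- lam * e / 4 * l], because
   [(1 - e) * (1 + e / 4) <= 1 - 3 / 4 * e]. *)
have T2 : expR (N%:R * psi - lam * D1) <= d / 3.
  have d3 : 0 < d / 3 by rewrite divr_gt0.
  rewrite -[leRHS]lnK ?posrE // ler_expR.
  have n1 : N%:R * psi <= psi + x * (lam * (k * (1 + e / 4))).
    apply: (@le_trans _ _ ((x + 1) * psi)); first exact: ler_wpM2r.
    have : x * psi <= x * (lam * (k * (1 + e / 4))) by exact: ler_wpM2l.
    lra.
  have n2 : x * (lam * (k * (1 + e / 4))) = lam * (l * ((1 - e) * (1 + e / 4))).
    by rewrite /x; field; rewrite gt_eqF.
  have n3 : lam * (l * ((1 - e) * (1 + e / 4))) <= lam * (l * (1 - 3 / 4 * e)).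
    by rewrite ler_pM2l // ler_pM2l //; have := mulr_gt0 e0 e0; lra.
  have n4 : (psi - ln (d / 3)) * 4 <= l * (lam * e) by rewrite -ler_pdivrMr ?mulr_gt0.
  rewrite /D1; lra.
(* Here [N <= 2 * (l / k)], and the second bound on [eta] then gives exactly [d / 3]. *)
have T3 : N%:R * eta / D2 <= d / 3.
  rewrite ler_pdivrMr // /D2.
  have m1 : 1 <= l / k by rewrite ler_pdivlMr // mul1r.
  apply: (@le_trans _ _ (2 * (l / k) * (k * e * d / 24))).
    by apply: ler_pM => //; [exact: ltW|lra].
  rewrite le_eqVlt; apply/orP; left; apply/eqP; field.
  by rewrite gt_eqF.
lra.
Unshelve. all: by end_near. Qed.

(** * Limits of the probability and of the normalised mean *)

Lemma P_Tinf_ge_cvg1 C (b : nat -> \bar R) :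
  (forall d : R, 0 < d ->
     \forall t \near \oo, ((1 - d)%:E <= P_Tinf_ge g F phi C (b t) t)%E) ->
  P_Tinf_ge g F phi C (b t) t @[t --> \oo] --> 1%E.
Proof.
move=> b1; have le1 t : (P_Tinf_ge g F phi C (b t) t <= 1)%E.
  rewrite -[leRHS](evalW_cst F phi C 1 t [tuple] [tuple] 0 g1).
  by apply: le_evalW => // n; case: ifP => // _; rewrite lee_fin.
have ge0 t : (0 <= P_Tinf_ge g F phi C (b t) t)%E.
  by apply: evalW_ge0 => // n; case: ifP => // _; rewrite lee_fin.
have fin t : P_Tinf_ge g F phi C (b t) t \is a fin_num.
  by rewrite ge0_fin_numE // (le_lt_trans (le1 t)) // ltry.
apply/fine_cvgP; split; first by near=> t; exact: fin.
apply/cvgrPdist_le => d d0; near=> t.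
have : ((1 - d)%:E <= P_Tinf_ge g F phi C (b t) t)%E by near: t; exact: b1.
have := le1 t; rewrite /= -{1 2}(fineK (fin t)) !lee_fin => h1 h2.
by rewrite ger0_norm; lra.
Unshelve. all: by end_near. Qed.

Lemma P_Tinf_ge_eq1 C (b : \bar R) t : (b <= 0)%E ->
  P_Tinf_ge g F phi C b t = 1%E.
Proof.
move=> b0; rewrite /P_Tinf_ge (_ : (fun c => _) = cst 1%:E).
  exact: evalW_cst.
apply/funext => n /=.
by rewrite (le_trans b0) // lee_fin.
Qed.

(** Passage to the complement: the two indicators add up to the constant 1, whose expectation is
    1. *)
Lemma P_Tinf_ge_lower C (b d : R) t :
  (E_Tinf g F phi C (fun c => if (c%:R < b)%R then 1 else 0) t <= d%:E)%E ->
  ((1 - d)%:E <= P_Tinf_ge g F phi C b%:E t)%E.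
Proof.
move=> h; rewrite EFinB leeBlDr //.
apply: le_trans (leeD (lexx _) h).
rewrite -[leLHS](evalW_cst F phi C 1 t [tuple] [tuple] 0 g1) /P_Tinf_ge /E_Tinf.
rewrite -evalWD //; last 2 first.
- by move=> n; case: ifP => // _; rewrite lee_fin.
- by move=> n; case: ifP => // _; rewrite lee_fin.
apply: le_evalW => // n; rewrite lee_fin.
by case: ltP => _; rewrite ?adde0 ?add0e.
Qed.

Lemma markov_Tinf C (b : R) t : 0 <= b ->
  (b%:E * P_Tinf_ge g F phi C b%:E t <= mean_Tinf g F phi C t)%E.
Proof.
move=> b0; rewrite /P_Tinf_ge /E_Tinf -evalWZ //; last first.
  by move=> n; case: ifP => // _; rewrite lee_fin.
apply: le_evalW => // n; rewrite lee_fin; case: ifP => bn;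
  by rewrite ?mule1 ?mule0 ?lee_fin.
Qed.

Lemma K_const_ge0 lo hi : Theta lo -> lo < hi -> (0 <= K_const Theta F lo hi)%E.
Proof.
move=> Tlo lohi; apply/ereal_infP => _ [th [Tth hith] <-].
(* A point of [X] is needed, since a supremum over an empty set would be [-oo]; there is one because
   [g] sums to 1. *)
have [x _|X0] := pickP X; last first.
  by move: g1; rewrite big_pred0 // => /esym/eqP; rewrite oner_eq0.
have lt : lo != th by rewrite lt_eqF // (lt_trans lohi).
have /andP[/ltW K0 _] := KLfin Tlo Tth lt x.
by apply: le_trans K0 _; apply: ereal_sup_ubound; exists x.
Qed.

(** The flag [a] lets one proof cover both orders of the parameters. The bound on the mean follows
    from the one on the probability by Markov's inequality. *)
Lemma lower_bound_arm (a : bool) (C : R * R) :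
  Theta (arm_param C a) -> Theta (arm_param C (~~ a)) ->
  arm_param C a < arm_param C (~~ a) ->
  let K := K_const Theta F (arm_param C a) (arm_param C (~~ a)) in
  ((0 < K)%E -> forall eps : R, 0 < eps ->
    P_Tinf_ge g F phi C (((1 - eps) * ln (t%:R))%:E / K)%E t
      @[t --> \oo] --> 1%E) /\
  (1 / K <= limn_einf (fun t : nat =>
              mean_Tinf g F phi C t / (ln (t%:R : R))%:E))%E.
Proof.
move=> Ta Tn aln K; have K0 : (0 <= K)%E by exact: K_const_ge0.
(* Any real [k] above the infimum [K] is beaten by the supremum at some admissible [th], which
   serves as the alternative parameter. *)
have small (k e d : R) : (K < k%:E)%E -> 0 < e < 1 -> 0 < d ->
    \forall t \near \oo, ((1 - d)%:E <=
      P_Tinf_ge g F phi C ((1 - e) * ln (t%:R : R) / k)%:E t)%E.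
  move=> Kk e01 d0; have k0 : 0 < k by rewrite -lte_fin (le_lt_trans K0).
  have [_ [th [Tth nth] <-] supk] := ereal_inf_lt Kk.
  have KLk x : (KLx F (arm_param C a) th x <= k%:E)%E.
    by apply: le_trans (ltW supk); apply: ereal_sup_ubound; exists x.
  have := E_Tinf_lt_small Ta Tn Tth aln nth KLk k0 e01 d0.
  by apply: filterS => t; exact: P_Tinf_ge_lower.
(* At [t = 0] this rests on the default value 0 of [ln] at 0. *)
have ln0 t : 0 <= ln (t%:R : R).
  by case: t => [|t]; [rewrite ln0|rewrite ln_ge0 // ler1n].
split.
- move=> Kpos e e0; apply: P_Tinf_ge_cvg1 => d d0.
  have triv b t : (b <= 0)%E -> ((1 - d)%:E <= P_Tinf_ge g F phi C b t)%E.
    by move=> b0; rewrite P_Tinf_ge_eq1 // lee_fin; lra.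
  case: K K0 Kpos small => [k| |] // _ Kpos small.
  + have k0 : 0 < k by rewrite -lte_fin.
    (* For [1 <= e] the threshold is at most 0 and the probability is 1. *)
    have [e1|e1] := leP 1 e.
      apply: nearW => t; apply: triv; rewrite inver gt_eqF // -EFinM lee_fin.
      by rewrite pmulr_lle0 ?invr_gt0 // mulr_le0_ge0 //; lra.
    (* chosen so that [(1 - e / 2) / k' = (1 - e) / k] *)
    pose k' := k * (1 - e / 2) / (1 - e).
    have e1' : 0 < 1 - e by lra.
    have kk' : (k%:E < k'%:E)%E by rewrite lte_fin ltr_pdivlMr // ltr_pM2l //; lra.
    have e2 : 0 < e / 2 < 1 by lra.
    apply: filterS (small k' (e / 2) d kk' e2 d0) => t.
    rewrite inver gt_eqF // -EFinM.
    rewrite (_ : (1 - e / 2) * _ / k' = (1 - e) * ln t%:R / k) //.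
    by rewrite /k'; field; rewrite !gt_eqF //; lra.
  (* For [K = +oo] the inverse is 0, and so is the threshold. *)
  + by apply: nearW => t; apply: triv; rewrite invey mule0.
have lim0 : (0 <= limn_einf (fun t : nat =>
    mean_Tinf g F phi C t / (ln (t%:R : R))%:E))%E.
  apply: limn_einf_ge; apply: nearW => t; apply: mule_ge0.
    by apply: evalW_ge0 => // n; rewrite lee_fin.
  by rewrite inve_ge0 lee_fin.
rewrite mul1e; have [->|Koo] := eqVneq K +oo%E; first by rewrite invey.
set L := limn_einf _ in lim0 *; rewrite leNgt; apply/negP => LK.
(* One factor [1 - e] comes from the threshold, the other from the probability in Markov's
   inequality. *)
have limq (q e : R) : 0 < q -> (K < (q^-1)%:E)%E -> 0 < e < 1 ->
    (((1 - e) ^+ 2 * q)%:E <= L)%E.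
  move=> q0 Kq e01; have /andP[e0 e1] := e01; apply: limn_einf_ge; near=> t.
  have l0 : 1 <= ln (t%:R : R) by near: t; exact: near_ln_ge.
  have Pt : ((1 - e)%:E <= P_Tinf_ge g F phi C ((1 - e) * ln (t%:R : R) / q^-1)%:E t)%E.
    by near: t; exact: small.
  have lpos : 0 < ln (t%:R : R) by lra.
  have b0 : 0 <= (1 - e) * ln (t%:R : R) / q^-1.
    by rewrite invrK !mulr_ge0 // ?ltW //; lra.
  rewrite inver gt_eqF // lee_pdivlMr //.
  apply: le_trans (markov_Tinf C t b0).
  apply: (@le_trans _ _ (((1 - e) * ln (t%:R : R) / q^-1)%:E * (1 - e)%:E)%E); last first.
    by apply: lee_wpmul2l; rewrite ?lee_fin.
  by rewrite -!EFinM lee_fin invrK le_eqVlt; apply/orP; left; apply/eqP; ring.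
have [r LE] : exists r, L = r%:E.
  case: L lim0 LK {limq} => [r| |] // _; first by exists r.
  by rewrite ltNge leey.
rewrite LE lee_fin in lim0; rewrite LE in LK limq.
(* A real strictly between [L] and [1 / K]: the midpoint, or [r + 1] when [K = 0] and the inverse is
   [+oo]. *)
have [q rq Kq] : exists2 q, r < q & (K < (q^-1)%:E)%E.
  case: K K0 Koo LK {small limq} => [k| |] // k0 _; rewrite inver.
  have [-> _|kn0] := eqVneq k 0.
    by exists (r + 1); [lra|rewrite lte_fin invr_gt0; lra].
  rewrite lte_fin => rk.
  have kpos : 0 < k by rewrite lt_neqAle eq_sym kn0 -lee_fin.
  have kVpos : 0 < k^-1 by rewrite invr_gt0.
  exists ((r + k^-1) / 2); first by lra.
  rewrite lte_fin -[ltLHS]invrK ltf_pV2 ?posrE //; lra.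
have q0 : 0 < q by lra.
(* With this [e], [(1 - e) ^+ 2 * q >= q - 2 * e * q = (q + r) / 2 > r], contradicting [limq]. *)
pose e := (q - r) / (4 * q).
have eE : e * (4 * q) = q - r by rewrite /e mulfVK // gt_eqF // mulr_gt0.
have e01 : 0 < e < 1.
  by rewrite divr_gt0 ?subr_gt0 ?mulr_gt0 // ltr_pdivrMr ?mulr_gt0 // mul1r; lra.
have := limq q e q0 Kq e01; rewrite lee_fin.
have : 0 <= e ^+ 2 * q by rewrite mulr_ge0 ?sqr_ge0 // ltW.
lra.
Unshelve. all: by end_near. Qed.

End lower_bound.

Theorem theorem5 (R : realType) (X : finType) (Theta : set R) (g : X -> R)
    (F : R -> X -> probability R R) (phi : rule X R) (th1 th2 : R) :
  (forall x : X, 0 < g x) -> \sum_(x : X) g x = 1 ->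
  (forall th (x : X), Theta th -> (F th x).-integrable [set: R] EFin) ->
  (forall th vth, Theta th -> Theta vth -> th != vth ->
     forall x : X, (0 < KLx F th vth x < +oo)%E) ->
  (forall (x : X) th th', Theta th -> Theta th' -> th < th' ->
     mean F th x < mean F th' x) ->
  measurable_rule phi -> uniformly_good Theta g F phi ->
  Theta th1 -> Theta th2 -> th1 != th2 ->
  let K := K_const Theta F (Num.min th1 th2) (Num.max th1 th2) in
  ((0 < K)%E ->
    forall eps : R, 0 < eps ->
    (fun t : nat =>
       P_Tinf_ge g F phi (th1, th2) (((1 - eps) * ln (t%:R))%:E / K)%E t)
      @ \oo --> 1%E) /\
  (1 / K <= limn_einf (fun t : nat =>
              mean_Tinf g F phi (th1, th2) t / (ln (t%:R : R))%:E))%E.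
Proof.
move=> g0 g1 _ KLfin mono mphi good T1 T2 /lt_total /orP[lt12|lt21].
  (* The inferior arm has the smaller parameter: [false] codes the first arm, [true] the second. *)
  rewrite min_l ?max_r ?ltW //.
  exact: (lower_bound_arm (fun x => ltW (g0 x)) g1 KLfin mono mphi good
    (a := false) (C := (th1, th2)) T1 T2 lt12).
rewrite min_r ?max_l ?ltW //.
exact: (lower_bound_arm (fun x => ltW (g0 x)) g1 KLfin mono mphi good
  (a := true) (C := (th1, th2)) T2 T1 lt21).
Qed.
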